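(* Let $Q$ be a finite quiver with vertex set $I$, and let $d,n\in\mathbf{N}I$ be dimension vectors. For every finite subforest $S_*$ of $\mathcal{F}_n(Q)$, $$Z_{S_*}=U_{S_*}\setminus\bigcup_{S'_*<S_*}U_{S'_*},$$ the union running over all finite subforests $S'_*$ of $\mathcal{F}_n(Q)$ with $S'_*<S_*$.
   Context: $\mathrm{H}_{d,n}(Q)$: fix complex vector spaces $M_q$ of dimension $d_q$ and $V_q$ of dimension $n_q$ with basis $(v_{q,i})_{1\le i\le n_q}$, for $q\in I$. $\mathrm{H}_{d,n}(Q)$ is the geometric quotient by $\prod_q\mathrm{GL}(M_q)$ (base change) of the open set of pairs $(M_*,f_* )$, $M_*=(M_\alpha:M_i\to M_j)_{\alpha:i\to j}$, $f_*=(f_q:V_q\to M_q)_{q\in I}$, such that the image of $f_*$ generates the representation $M_*$ (no proper subrepresentation contains it). Forests: a path $w=\alpha_1\cdots\alpha_m$ in $Q$ is a word of composable arrows, $\alpha_1$ traversed first; there is an empty path $()$ at each vertex; $t(w)$ is the terminal vertex of $w$ ($t(())=q$ for the empty path at $q$). $M_w=M_{\alpha_m}\circ\cdots\circ M_{\alpha_1}$ (identity for the empty path). $T_q$ is the tree of all paths starting in $q$, with edges $\alpha_1\cdots\alpha_m\to\alpha_1\cdots\alpha_m\alpha_{m+1}$. $\mathcal{F}_n(Q)$ consists of $n_q$ copies $T_{q,1},\dots,T_{q,n_q}$ of $T_q$ for each $q\in I$; its vertices are triples $(q,i,w)$. A subforest $S_*=(S_{q,i})$ consists of subsets $S_{q,i}\subset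 T_{q,i}$ (possibly empty) closed under predecessors (initial subwords). Orders: fix a total order on $I$ and a total order on each set of parallel arrows. For arrows $\alpha:i\to j$, $\beta:k\to\ell$ set $\alpha<\beta$ if $i<k$, or $i=k$ and $j<\ell$, or $i=k$, $j=\ell$ and $\alpha<\beta$ in the chosen order. Paths from the same vertex are ordered lexicographically: $w<w'$ if at the first position where they differ the arrow of $w$ is smaller, or if $w$ is a proper initial subword of $w'$. Triples: $(q,i,w)<(q',i',w')$ if $q<q'$, or $q=q'$ and $i<i'$, or $q=q'$, $i=i'$ and $w<w'$. Finite trees $S=\{w_1<\dots<w_j\}$, $S'=\{w'_1<\dots<w'_k\}$: $S<S'$ if $|S|>|S'|$, or $|S|=|S'|$ and $w_\ell<w'_\ell$ for the minimal $\ell$ with $w_\ell\ne w'_\ell$. Finite subforests: $S_*<S'_*$ if $S_{q,i}<S'_{q,i}$ for the smallest $(q,i)$ (ordered by $q$, then $i$) with $S_{q,i}\neq S'_{q,i}$. $U_{S_*}\subset\mathrm{H}_{d,n}(Q)$ is the set of classes of $(M_*,f_* )$ such that for every $j\in I$ the elements $M_wf_q(v_{q,i})$, $(q,i,w)\in S_*$ with $t(w)=j$, form a basis of $M_j$. Corona: $C(S_* )$ is the set of $(q,i,w)\in\mathcal{F}_n(Q)$, $w=\alpha_1\cdots\alpha_\ell$, with $w\notin S_{q,i}$ but $\alpha_1\cdots\alpha_{\ell-1}\in S_{q,i}$; also $(q,i,())\in C(S_* )$ whenever $S_{q,i}=\emptyset$. $Z_{S_*}$ is the set of $(M_*,f_*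 )\in U_{S_*}$ such that for all $(q,i,w)\in C(S_* )$, the element $M_wf_q(v_{q,i})$ lies in the span of the elements $M_{w'}f_{q'}(v_{q',i'})$ with $(q',i',w')\in S_*$, $(q',i',w')<(q,i,w)$, $t(w')=t(w)$. *)

(* Defs.v *)
From HB Require Import structures.
From mathcomp Require Import all_boot all_order all_algebra finmap.
From mathcomp Require Import complex.
From mathcomp Require Import boolp classical_sets reals.

Set Implicit Arguments.
Unset Strict Implicit.
Unset Printing Implicit Defensive.

Import Order.TTheory GRing.Theory.

Local Open Scope classical_set_scope.
Local Open Scope ring_scope.

(* A finite quiver together with a total order on its vertex set and on each
   set of parallel arrows is a finOrderType I and a family A of finOrderTypes:
   A i j is the set of arrows from i to j. *)

Section Paths.
Variables (dI dA : Order.disp_t) (I : finOrderType dI).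
Variable A : I -> I -> finOrderType dA.

(* The order on this sigma type is lexicographic: first the source, then the
   target, then the chosen order on parallel arrows. *)
Definition arrow := {i : I & {j : I & A i j}}.

Definition mk_arrow i j (a : A i j) : arrow :=
  Tagged (fun i => {j : I & A i j}) (Tagged (fun j => A i j) a).

(* Paths from q, by terminal vertex; the last constructor appends the arrow
   that is traversed last. *)
Inductive qpath (q : I) : I -> Type :=
| qnil : qpath q q
| qsnoc j k of qpath q j & A j k : qpath q k.

Fixpoint qword q k (w : qpath q k) : seq arrow :=
  if w is qsnoc _ _ u a then rcons (qword u) (mk_arrow a) else [::].

Definition tree q := {k : I & qpath q k}.

Definition tnil q : tree q := Tagged (qpath q) (qnil q).

Definition tsnoc q (w : tree q) k (a : A (tag w) k) : tree q :=
  Tagged (qpath q) (qsnoc (tagged w) a).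

(* Words carry the lexicographic order of the library, for which a proper
   initial subword is smaller. *)
Definition word q (w : tree q) : seqlexi arrow := qword (tagged w).

(* Partial inverse of word, used to make tree q a choiceType. *)
Definition extend_word q (w : option (tree q)) (b : arrow) : option (tree q) :=
  if w is Some u then
    if tag u =P tag b is ReflectT e then
      Some (Tagged (qpath q)
        (qsnoc (ecast i (qpath q i) e (tagged u)) (tagged (tagged b))))
    else None
  else None.

Definition unword q (s : seqlexi arrow) : option (tree q) :=
  foldl (@extend_word q) (Some (tnil q)) s.

Lemma wordK q : pcancel (@word q) (@unword q).
Proof.
case=> k; elim=> [//|j {}k u IHu a].
rewrite /word /unword /= foldl_rcons.
rewrite /word /unword /= in IHu; rewrite IHu /=.
by case: eqP => // e; rewrite (eq_axiomK e).
Qed.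

HB.instance Definition _ q := Choice.copy (tree q) (pcan_type (@wordK q)).

End Paths.

Arguments qnil {dI dA I A} q.
Arguments tnil {dI dA I} A q.

Section Forests.
Variables (dI dA : Order.disp_t) (I : finOrderType dI).
Variables (A : I -> I -> finOrderType dA) (n : I -> nat).

(* The copies T_{q,i} of the trees, ordered by q, then i (library order on the
   sigma type). *)
Definition copies := {q : I & 'I_(n q)}.

(* Vertices (p, w) of the forest, with p = (q, i). *)
Definition vertex_lt (p' : copies) (w' : tree A (tag p'))
    (p : copies) (w : tree A (tag p)) : bool :=
  (p' < p)%O || (p' == p) && (word w' < word w)%O.

Definition forest := forall p : copies, {fset tree A (tag p)}.

Definition is_subforest (S : forest) : Prop :=
  forall (p : copies) (u w : tree A (tag p)),
    seq.prefix (word u) (word w) -> w \in S p -> u \in S p.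

Inductive corona (S : forest) (p : copies) : tree A (tag p) -> Prop :=
| corona_root of S p = fset0 : corona S (tnil A (tag p))
| corona_step (w : tree A (tag p)) k (a : A (tag w) k) of
    w \in S p & tsnoc a \notin S p : corona S (tsnoc a).

(* The l-th smallest element of a finite tree, counted from 0, as a word. *)
Definition nth_word q (S : {fset tree A q}) (l : nat) : seqlexi (arrow A) :=
  nth [::] (sort <=%O [seq word w | w <- enum_fset S]) l.

Definition tree_lt q (S S' : {fset tree A q}) : Prop :=
  (#|` S'| < #|` S|)%N \/
  #|` S| = #|` S'| /\
  exists l : nat,
    [/\ (l < #|` S|)%N,
        forall m, (m < l)%N -> nth_word S m = nth_word S' m
      & (nth_word S l < nth_word S' l)%O].

Definition forest_lt (S S' : forest) : Prop :=
  exists p : copies,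
    (forall p' : copies, (p' < p)%O -> S p' = S' p') /\ tree_lt (S p) (S' p).

End Forests.

Section Moduli.
Variables (dI dA : Order.disp_t) (I : finOrderType dI).
Variables (A : I -> I -> finOrderType dA) (n : I -> nat).
Variables (R : realType) (M V : I -> vectType R[i]).
Variable v : forall q, (n q).-tuple (V q).

Record framed := Framed {
  rep : forall i j, A i j -> 'Hom(M i, M j);
  frame : forall q, 'Hom(V q, M q) }.

Definition is_subrep (x : framed) (N : forall q, {vspace M q}) : Prop :=
  forall i j (a : A i j), (rep x a @: N i <= N j)%VS.

Definition is_generated (x : framed) : Prop :=
  forall N : (forall q, {vspace M q}),
    is_subrep x N -> (forall q, limg (frame x q) <= N q)%VS ->
    forall q, N q = fullv.

Definition gl_act (g : forall q, 'End(M q)) (x : framed) : framed :=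
  Framed (fun i j (a : A i j) => (g j \o rep x a \o (g i)^-1)%VF)
         (fun q => (g q \o frame x q)%VF).

Definition gl_orbit (x : framed) : set framed :=
  [set gl_act g x | g in [set g : forall q, 'End(M q) |
                           forall q, bijective (g q)]].

(* The points of H_{d,n}(Q): the geometric quotient is the orbit space. *)
Definition moduli : set (set framed) := [set gl_orbit x | x in is_generated].

Fixpoint path_map (x : framed) q j (w : qpath A q j) : 'Hom(M q, M j) :=
  match w with
  | qnil => \1%VF
  | qsnoc _ _ u a => (rep x a \o path_map x u)%VF
  end.

Definition val_at (x : framed) (p : copies n) j (w : qpath A (tag p) j) : M j :=
  path_map x w (frame x (tag p) (tnth (v (tag p)) (tagged p))).

(* The family of the M_w f_q(v_{q,i}) in M_j, over those (q,i,w) in S with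
   t(w) = j that satisfy P. The filter makes the default value 0 of untag, used
   when t(w) <> j, irrelevant. *)
Definition family_at (x : framed) (S : forest A n)
    (P : forall p : copies n, tree A (tag p) -> bool) (j : I) : seq (M j) :=
  [seq untag 0 (@val_at x p j) w |
     p <- enum {: copies n},
     w <- [seq w <- enum_fset (S p) | (tag w == j) && P p w]].

Definition is_basis (S : forest A n) (x : framed) : Prop :=
  forall j, basis_of fullv (family_at x S (fun _ _ => true) j).

Definition is_reduced (S : forest A n) (x : framed) : Prop :=
  forall (p : copies n) (w : tree A (tag p)), corona S w ->
    val_at x (tagged w) \in
      <<family_at x S (fun p' w' => vertex_lt w' w) (tag w)>>%VS.

Definition U_ (S : forest A n) : set moduli :=
  [set c : moduli | exists2 x, x \in \val c & is_basis S x].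

Definition Z_ (S : forest A n) : set moduli :=
  [set c : moduli |
     exists x, [/\ x \in \val c, is_basis S x & is_reduced S x]].

End Moduli.

Arguments U_ {dI dA I A n R} M {V} v S.
Arguments Z_ {dI dA I A n R} M {V} v S.

(* Main.v *)
(* Two facts on a framed representation x and a copy p drive the proof.

   If x is reduced for S, the span of the vectors of S in the copies up to p is
   a subrepresentation, so it contains all the vectors of these copies. A basis
   forest S' that agrees with S before p therefore satisfies |S'_p| <= |S_p|. If
   S' < S with first difference at p, equality holds, and the first vertex w of
   S'_p that is not in S_p lies in the corona of S. Reducedness puts its vector
   in the span of earlier vertices of S, all of which belong to S', which
   contradicts the freeness of S'.

   Conversely, let w be a corona vertex in copy p whose vector is not in the
   span of the earlier vertices of S. Then w and these vertices form a free
   subforest. Extend it to a maximal free subforest of the copies up to p, then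
   of the whole forest: the result S' is a basis forest. The first step spans
   all the vectors of the copies up to p, whence |S'_p| >= |S_p| when S' and S
   agree before p; as S' contains w and everything of S before w, S' < S. *)

Require Import Defs.
From mathcomp Require Import all_boot all_order all_algebra finmap.
From mathcomp Require Import complex.
From mathcomp Require Import boolp classical_sets reals.

Set Implicit Arguments.
Unset Strict Implicit.
Unset Printing Implicit Defensive.

Import Order.TTheory GRing.Theory.

(** * First differences of strictly sorted sequences *)

Section SortedSequences.
Variables (d : Order.disp_t) (T : orderType d) (x0 : T).
Implicit Types s t : seq T.

(** Let l be the first index of difference and suppose s_l < t_l. Then s_l is not in t, so w <= s_l
    by the last hypothesis. As w is in t but not in s, its index in t is at least l, whence w >= t_l
    > s_l, a contradiction. *)
Lemma nth_first_difference s t :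
    sorted <%O s -> sorted <%O t -> size s = size t ->
    forall w, w \in t -> w \notin s ->
    {in s, forall u, (u < w)%O -> u \in t} ->
  exists l, [/\ (l < size t)%N,
    forall m, (m < l)%N -> nth x0 t m = nth x0 s m
    & (nth x0 t l < nth x0 s l)%O].
Proof.
move=> ss st eq_sz w wt ws st_lt.
have [l]: exists l, (l < size t)%N && (nth x0 t l != nth x0 s l).
  apply/not_existsP => eq_st; case/negP: ws.
  have <- // : t = s; apply: (@eq_from_nth _ x0) => // i i_lt.
  by apply/eqP/negPn/negP => neq; apply: (eq_st i); rewrite i_lt.
have le_t := lt_sorted_leq_nth x0 st.
elim/ltn_ind: l => l IHl /andP[l_lt neq_l].
have [[m /andP[m_lt neq_m]]|eq_lt] :=
    pselect (exists m, (m < l)%N && (nth x0 t m != nth x0 s m)).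
  by apply: (IHl m) => //; rewrite (ltn_trans m_lt).
have {}eq_lt m : (m < l)%N -> nth x0 t m = nth x0 s m.
  by move=> m_lt; apply/eqP/negPn/negP => neq; apply: eq_lt; exists m; rewrite m_lt.
exists l; split=> //; rewrite ltNge le_eqVlt negb_or eq_sym neq_l /=.
apply/negP => lt_l.
have l_lts : (l < size s)%N by rewrite eq_sz.
have notin_t : nth x0 s l \notin t.
  apply/negP => /(nthP x0)[m m_lt eq_m].
  have [m_l|l_m] := ltnP m l.
    move: eq_m; rewrite eq_lt // => /eqP.
    by rewrite nth_uniq ?lt_sorted_uniq ?(ltn_trans m_l)// (ltn_eqF m_l).
  by move: lt_l; rewrite -eq_m ltNge le_t // l_m.
have lew : (w <= nth x0 s l)%O.
  rewrite leNgt; apply/negP => ltw.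
  by case/negP: notin_t; apply: st_lt => //; rewrite mem_nth.
case/(nthP x0): wt ws lew => m m_lt <- ws; rewrite leNgt => /negP; apply.
have [m_l|l_m] := ltnP m l.
  by case/negP: ws; rewrite eq_lt // mem_nth // (ltn_trans m_l).
by apply: lt_le_trans lt_l _; rewrite le_t.
Qed.

(** By sortedness, an element of s or t below t_l can only occur at an index below l, where the two
    sequences agree. *)
Lemma mem_first_difference s t l :
    sorted <%O s -> sorted <%O t -> size s = size t -> (l < size t)%N ->
    (forall m, (m < l)%N -> nth x0 t m = nth x0 s m) ->
    (nth x0 t l < nth x0 s l)%O ->
  nth x0 t l \notin s /\ (forall u, (u < nth x0 t l)%O -> (u \in t) = (u \in s)).
Proof.
move=> ss st eq_sz l_lt eq_lt lt_l.
have le_s := lt_sorted_leq_nth x0 ss.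
have lt_t := lt_sorted_ltn_nth x0 st.
split.
  apply/negP => /(nthP x0)[m m_lt eq_m].
  have [m_l|l_m] := ltnP m l.
    have /eqP := eq_m; rewrite -eq_lt // nth_uniq ?lt_sorted_uniq //.
      by rewrite (ltn_eqF m_l).
    exact: ltn_trans l_lt.
  by move: lt_l; rewrite -eq_m ltNge le_s // ?inE ?eq_sz ?l_m.
move=> u u_lt; apply/idP/idP => /(nthP x0)[m m_lt eq_m].
  have m_l : (m < l)%N by rewrite -(lt_t m l) // eq_m.
  by rewrite -eq_m eq_lt // mem_nth // eq_sz.
have m_l : (m < l)%N.
  rewrite ltnNge; apply/negP => l_m; move: u_lt; rewrite -eq_m.
  by rewrite ltNge (le_trans (ltW lt_l)) // le_s // ?inE ?eq_sz.
by rewrite -eq_m -eq_lt // mem_nth // -eq_sz.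
Qed.

End SortedSequences.

(** * Paths as words, and the order on finite trees *)

Section Words.
Variables (dI dA : Order.disp_t) (I : finOrderType dI).
Variable A : I -> I -> finOrderType dA.

Lemma word_inj q : injective (@word _ _ I A q).
Proof. exact: pcan_inj (@wordK _ _ _ _ q). Qed.

Lemma ltxi_rcons d d' (T : orderType d) (s : seqlexi_with d' T) (x : T) :
  (s < (rcons s x : seqlexi_with d' T))%O.
Proof. by elim: s => [//|y s IHs]; rewrite rcons_cons eqhead_ltxiE. Qed.

Lemma word_tsnoc q (w : tree A q) k (a : A (tag w) k) :
  (word w < word (tsnoc a))%O.
Proof. exact: ltxi_rcons. Qed.

Lemma tree_ind q (P : tree A q -> Prop) :
    P (tnil A q) -> (forall w k (a : A (tag w) k), P w -> P (tsnoc a)) ->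
  forall w, P w.
Proof.
move=> P0 PS [k w]; elim: w => [//|i j u IHu a].
exact: (PS (Tagged (qpath A q) u) _ a).
Qed.

Lemma prefix_rconsE (T : eqType) (s t : seq T) x :
  prefix s (rcons t x) = (s == rcons t x) || prefix s t.
Proof.
apply/idP/orP => [/prefixP[r]|[/eqP->|st]]; last 2 first.
- exact: prefix_refl.
- exact: prefix_trans st (prefix_rcons _ _).
case/lastP: r => [|r y]; first by rewrite cats0 => ->; left.
by rewrite -rcons_cat => /rcons_inj[-> _]; right; apply: prefix_prefix.
Qed.

Section TreeOrder.
Variable q : I.
Implicit Types S : {fset tree A q}.

Let sorted_words S := sort <=%O [seq word w | w <- enum_fset S].

Let sorted_words_lt S : sorted <%O (sorted_words S).
Proof. by rewrite sort_lt_sorted map_inj_uniq ?fset_uniq //; apply: word_inj. Qed.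

Let size_sorted_words S : size (sorted_words S) = #|` S|.
Proof. by rewrite size_sort size_map. Qed.

Let mem_sorted_words S w : (word w \in sorted_words S) = (w \in S).
Proof. by rewrite mem_sort mem_map //; apply: word_inj. Qed.

(** If the cardinalities differ, the larger tree S' is smaller by definition; otherwise
    [nth_first_difference] applies to the sorted words. *)
Lemma tree_lt_of_smaller S S' w :
    (#|` S| <= #|` S'|)%N -> w \in S' -> w \notin S ->
    {in S, forall u, (word u < word w)%O -> u \in S'} ->
  tree_lt S' S.
Proof.
move=> le_card wS' wS lt_w.
move: le_card; rewrite leq_eqVlt => /orP[/eqP eq_card|]; last by left.
right; split=> //.
have [|||| l [l_lt eq_lt lt_l]] := @nth_first_difference _ (seqlexi (arrow A)) [::] _ _
  (sorted_words_lt S) (sorted_words_lt S') _ (word w).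
- by rewrite !size_sorted_words.
- by rewrite mem_sorted_words.
- by rewrite mem_sorted_words.
- move=> _ /[1!mem_sort] /mapP[u uS ->] /(lt_w _ uS).
  by rewrite mem_sorted_words.
by exists l; split; rewrite -?size_sorted_words.
Qed.

(** The cardinality bound excludes the first alternative of [tree_lt], and w is the entry of S' at
    the first difference. *)
Lemma tree_lt_smaller S S' :
    tree_lt S' S -> (#|` S'| <= #|` S|)%N ->
  exists w, [/\ w \in S', w \notin S
    & forall u, (word u < word w)%O -> (u \in S') = (u \in S)].
Proof.
case=> [|[eq_card [l [l_lt eq_lt lt_l]]] _]; first by rewrite ltnNge => /negP.
have sizeS : size (sorted_words S) = size (sorted_words S').
  by rewrite !size_sorted_words.
have l_size : (l < size (sorted_words S'))%N by rewrite size_sorted_words.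
have [notS lt_in] := mem_first_difference
  (sorted_words_lt S) (sorted_words_lt S') sizeS l_size eq_lt lt_l.
have := mem_nth [::] l_size; rewrite {2}/sorted_words mem_sort.
case/mapP=> w wS' eq_w.
exists w; split=> //; first by rewrite -mem_sorted_words -eq_w.
by move=> u; rewrite -eq_w => /lt_in; rewrite !mem_sorted_words.
Qed.

End TreeOrder.
End Words.

(** * Subforests as sequences of vertices *)

Section Vertices.
Variables (dI dA : Order.disp_t) (I : finOrderType dI).
Variables (A : I -> I -> finOrderType dA) (n : I -> nat).

Definition vertex := {p : copies n & tree A (tag p)}.

Definition mk_vertex (p : copies n) (w : tree A (tag p)) : vertex :=
  Tagged (fun p : copies n => tree A (tag p)) w.

(* The root is its own parent. *)
Definition parent q (w : tree A q) : tree A q :=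
  match tagged w with
  | qnil => tnil A q
  | qsnoc _ _ u _ => Tagged (qpath A q) u
  end.

Definition vparent (u : vertex) : vertex := mk_vertex (parent (tagged u)).

(** One-step form of closure under predecessors, convenient when a forest is built by adding one
    vertex at a time. *)
Definition parent_closed (s : seq vertex) := {in s, forall u, vparent u \in s}.

Lemma parent_tsnoc q (w : tree A q) k (a : A (tag w) k) : parent (tsnoc a) = w.
Proof. by case: w a. Qed.

Lemma vparent_tsnoc (p : copies n) (w : tree A (tag p)) k (a : A (tag w) k) :
  vparent (mk_vertex (tsnoc a)) = mk_vertex w.
Proof. by rewrite /vparent /= parent_tsnoc. Qed.

Lemma prefix_parent q (w : tree A q) : prefix (word (parent w)) (word w).
Proof. by case: w => k [] //= i j u a; apply: prefix_rcons. Qed.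

Lemma word_parent q (w : tree A q) : (word (parent w) <= word w)%O.
Proof. by case: w => k [] //= i j u a; rewrite ltW //; apply: ltxi_rcons. Qed.

Definition vertices (S : forest A n) : seq vertex :=
  [seq mk_vertex w | p <- enum {: copies n}, w <- enum_fset (S p)].

Lemma mem_vertices (S : forest A n) (p : copies n) (w : tree A (tag p)) :
  (mk_vertex w \in vertices S) = (w \in S p).
Proof.
apply/allpairsPdep/idP => [[p' [w' [_ w'S eq_w]]]|wS].
  have eq_p : p = p' := congr1 tag eq_w.
  case: _ / eq_p w' w'S eq_w => w' w'S.
  by move/eqP; rewrite eq_Tagged => /eqP/= ->.
by exists p, w; rewrite mem_enum.
Qed.

Lemma uniq_vertices (S : forest A n) : uniq (vertices S).
Proof.
apply: allpairs_uniq_dep => [|p _|]; first exact: enum_uniq.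
  exact: fset_uniq.
by case=> p w [p' w'] _ _ eq_w.
Qed.

Lemma subforest_parent_closed (S : forest A n) :
  is_subforest S -> parent_closed (vertices S).
Proof.
move=> subS [p w]; rewrite !mem_vertices => wS.
exact: subS (prefix_parent w) wS.
Qed.

Definition vertices_upto (p : copies n) (S : forest A n) : seq vertex :=
  [seq u <- vertices S | (tag u <= p)%O].

Lemma size_vertices_upto p (S : forest A n) :
  size (vertices_upto p S) = \sum_(p' : copies n | (p' <= p)%O) #|` S p'|.
Proof.
rewrite size_filter count_flatten -map_comp sumnE big_map big_enum /=.
rewrite [RHS]big_mkcond.
apply: eq_bigr => p' _; rewrite count_map; case: ifP => p'p.
  by rewrite -count_predT; apply: eq_count => w; rewrite /= p'p.
by rewrite -(count_pred0 (S p')); apply: eq_count => w; rewrite /= p'p.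
Qed.

(** Both sizes are sums of cardinalities over the copies up to p, and the summands before p
    cancel. *)
Lemma card_tree_le p (S S' : forest A n) :
    (forall p', (p' < p)%O -> S p' = S' p') ->
    (size (vertices_upto p S) <= size (vertices_upto p S'))%N ->
  (#|` S p| <= #|` S' p|)%N.
Proof.
move=> eqS; rewrite !size_vertices_upto (bigD1 p) //=.
rewrite [X in (_ <= X)%N -> _](bigD1 p) //=.
rewrite [X in (_ <= _ + X)%N -> _](eq_bigr (fun p' => #|` S p'|)) ?leq_add2r //.
by move=> p' /andP[p'p neq]; rewrite eqS // lt_neqAle neq.
Qed.

(** The root is only a default for [tagged_as]; the filter ensures that it is never returned for
    lack of a matching tag. *)
Definition forest_of (s : seq vertex) : forest A n := fun p =>
  [fset tagged_as (mk_vertex (tnil A (tag p))) u | u in [seq u <- s | tag u == p]]%fset.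

Lemma mem_forest_of s p w : (w \in forest_of s p) = (mk_vertex w \in s).
Proof.
apply/imfsetP/idP => [[[p' w'] /=]|ws].
  rewrite mem_filter /= => /andP[/eqP eq_p w's ->].
  by case: _ / eq_p w's => /=; rewrite tagged_asE.
by exists (mk_vertex w); rewrite /= ?mem_filter ?eqxx // tagged_asE.
Qed.

Lemma perm_forest_of s : uniq s -> perm_eq (vertices (forest_of s)) s.
Proof.
move=> uniq_s; apply: uniq_perm => // [|[p w]]; first exact: uniq_vertices.
by rewrite mem_vertices mem_forest_of.
Qed.

Lemma subforest_forest_of s : parent_closed s -> is_subforest (forest_of s).
Proof.
move=> closed_s p u w; rewrite !mem_forest_of.
elim/tree_ind: w => [|w k a IHw].
  by rewrite prefixs0 => /eqP eq_u; rewrite (word_inj (eq_u : _ = word (tnil A _))).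
rewrite [word _]/= prefix_rconsE => /orP[/eqP eq_u|/IHw uw /closed_s].
  by rewrite (word_inj (eq_u : _ = word (tsnoc a))).
by rewrite vparent_tsnoc.
Qed.

End Vertices.

(** * Independence and spans of families of vertices *)

Section Families.
Variables (dI dA : Order.disp_t) (I : finOrderType dI).
Variables (A : I -> I -> finOrderType dA) (n : I -> nat).
Variables (R : realType) (M V : I -> vectType R[i]).
Variables (v : forall q, (n q).-tuple (V q)) (x : framed A M V).
Local Notation vertex := (vertex A n).
Implicit Types (s t : seq vertex) (u : vertex) (j : I).

(* The default value 0 of untag is never used, because of the filter. *)
Definition fam j s : seq (M j) :=
  [seq untag 0%R (@val_at _ _ _ A n R M V v x (tag u) j) (tagged u)
     | u <- s & tag (tagged u) == j].

Lemma family_atE (S : forest A n) P j :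
  family_at v x S P j = fam j [seq u <- vertices S | P (tag u) (tagged u)].
Proof.
rewrite /family_at /fam /vertices; elim: (enum _) => [//|p e IHe].
rewrite !allpairs_cons !filter_cat map_cat -IHe; congr (_ ++ _).
by rewrite -filter_predI filter_map -map_comp.
Qed.

Definition indep s := forall j, free (fam j s).

Definition spanned s u :=
  val_at v x (tagged (tagged u)) \in <<fam (tag (tagged u)) s>>%VS.

Lemma mem_fam s j y : y \in fam j s ->
  exists (p : copies n) (w : qpath A (tag p) j),
    mk_vertex (Tagged (qpath A (tag p)) w) \in s /\ y = val_at v x w.
Proof.
case/mapP=> -[p [k w]]; rewrite mem_filter => /andP[/= /eqP eq_k].
move=> ws ->; case: _ / eq_k; exists p, w; split=> //.
by rewrite (untagE _ _ (erefl k : tag (Tagged (qpath A (tag p)) w) = k)).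
Qed.

Lemma fam_cons u s j : fam j (u :: s) =
  if tag (tagged u) == j then
    untag 0%R (@val_at _ _ _ A n R M V v x (tag u) j) (tagged u) :: fam j s
  else fam j s.
Proof. by rewrite /fam /=; case: ifP. Qed.

Lemma untag_val u : untag 0%R
    (@val_at _ _ _ A n R M V v x (tag u) (tag (tagged u))) (tagged u) =
  val_at v x (tagged (tagged u)).
Proof. by rewrite (untagE _ _ (erefl (tag (tagged u)))). Qed.

Lemma spanned_mem s u : u \in s -> spanned s u.
Proof.
move=> us; apply: memv_span; apply/mapP.
by exists u; rewrite ?mem_filter ?eqxx ?untag_val.
Qed.

Lemma span_fam_sub s t j :
  {in s, forall u, spanned t u} -> (<<fam j s>> <= <<fam j t>>)%VS.
Proof.
move=> s_t; apply/span_subvP => y /mem_fam[p [w [ws ->]]].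
exact: s_t ws.
Qed.

Lemma spanned_sub s t u : {subset s <= t} -> spanned s u -> spanned t u.
Proof.
by move=> st; apply/subvP/span_fam_sub => u' /st; apply: spanned_mem.
Qed.

Lemma indep_cons s u : indep s -> ~~ spanned s u -> indep (u :: s).
Proof.
move=> indep_s not_span j; rewrite fam_cons; case: eqP => [|//].
by case: _ /; rewrite free_cons untag_val not_span indep_s.
Qed.

Lemma perm_indep s t : perm_eq s t -> indep s -> indep t.
Proof.
by move=> st indep_s j; rewrite -(perm_free (perm_map _ (perm_filter _ st))).
Qed.

Lemma indep_filter P s : indep s -> indep (filter P s).
Proof.
elim: s => [//|u s IHs] indep_us /=.
have indep_s : indep s.
  move=> j; have := indep_us j; rewrite fam_cons; case: ifP => // _.
  by rewrite free_cons => /andP[].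
case: ifP => _; last exact: IHs.
apply: indep_cons; first exact: IHs.
have := indep_us (tag (tagged u)); rewrite fam_cons eqxx untag_val free_cons.
case/andP=> not_span _; apply: contra not_span; apply: spanned_sub.
by move=> u'; rewrite mem_filter => /andP[].
Qed.

Lemma indep_not_spanned s t u : indep s -> u \in s ->
  {subset t <= s} -> u \notin t -> ~~ spanned t u.
Proof.
move=> /perm_indep indep_s us ts ut.
have {indep_s} := indep_s _ (perm_to_rem us) (tag (tagged u)).
rewrite fam_cons eqxx untag_val free_cons => /andP[not_span _].
apply: contra not_span; apply: spanned_sub => u' u't.
have := perm_mem (perm_to_rem us) u'; rewrite ts // inE => /esym/orP[/eqP eq_u|//].
by rewrite -eq_u u't in ut.
Qed.

(** Each path has exactly one terminal vertex. This turns dimension bounds in the separate spaces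
    M_j into bounds on the number of vertices. *)
Lemma sum_size_fam s : \sum_(j : I) size (fam j s) = size s.
Proof.
elim: s => [|u s IHs]; first by rewrite big1.
rewrite /= -IHs (bigD1 (tag (tagged u))) //= [in RHS](bigD1 (tag (tagged u))) //=.
rewrite fam_cons eqxx -addSn; congr (_ + _)%N.
by apply: eq_bigr => j neq; rewrite fam_cons eq_sym (negbTE neq).
Qed.

Lemma size_indep_le s t :
  indep s -> {in s, forall u, spanned t u} -> (size s <= size t)%N.
Proof.
move=> indep_s s_t; rewrite -!sum_size_fam; apply: leq_sum => j _.
have /eqP <- := indep_s j.
by apply: leq_trans (dim_span _); apply: dimvS; apply: span_fam_sub.
Qed.

Lemma size_indep s : indep s -> (size s <= \sum_(j : I) \dim {:M j})%N.
Proof.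
move=> indep_s; rewrite -sum_size_fam; apply: leq_sum => j _.
by have /eqP <- := indep_s j; apply: dimvS; apply: subvf.
Qed.

(* Under s_step the spans of s form a subrepresentation. *)
Lemma spanned_copy s p :
    spanned s (mk_vertex (tnil A (tag p))) ->
    (forall p' (w : tree A (tag p')) k (a : A (tag w) k),
       mk_vertex w \in s -> spanned s (mk_vertex (tsnoc a))) ->
  forall w : tree A (tag p), spanned s (mk_vertex w).
Proof.
move=> s_root s_step; elim/tree_ind => [//|w k a IHw].
have subrep : (rep x a @: <<fam (tag w) s>> <= <<fam k s>>)%VS.
  rewrite limg_span; apply/span_subvP => _ /mapP[y /mem_fam[p' [w' [w's ->]]] ->].
  have := s_step p' (Tagged (qpath A (tag p')) w') k a w's.
  by rewrite /spanned /val_at /= lfunE.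
rewrite /spanned /val_at /= lfunE /=.
by apply: subvP subrep _ _; apply: memv_img.
Qed.

(** Greedy extension: as long as some root of a copy in Q, or some child of a vertex of s, is not
    spanned, adding it preserves independence and closure under parents. When none is left,
    [spanned_copy] shows that s spans all the copies in Q. *)
Lemma extend_indep (Q : pred (copies n)) s :
    uniq s -> parent_closed s -> indep s -> {in s, forall u, Q (tag u)} ->
  exists t, [/\ {subset s <= t}, [/\ uniq t, parent_closed t & indep t],
    {in t, forall u, Q (tag u)} &
    forall p (w : tree A (tag p)), Q p -> spanned t (mk_vertex w)].
Proof.
(* The total dimension bounds the size of an independent family, so this difference drops with each
   added vertex. *)
have [m] := ubnP (\sum_(j : I) \dim {:M j} - size s)%N.
elim: m s => [//|m IHm] s lt_m uniq_s closed_s indep_s Qs.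
have add u : Q (tag u) -> ~~ spanned s u -> vparent u \in u :: s ->
    exists t, [/\ {subset s <= t}, [/\ uniq t, parent_closed t & indep t],
      {in t, forall u, Q (tag u)} &
      forall p (w : tree A (tag p)), Q p -> spanned t (mk_vertex w)].
  move=> Qu not_span u_parent.
  have indep_us := indep_cons indep_s not_span.
  have [||||t [us_t t_good Qt t_span]] := IHm (u :: s) _ _ _ indep_us.
  - have := size_indep indep_us; rewrite /= => le_us.
    by move: lt_m; rewrite -(subnSK le_us) ltnS.
  - by rewrite /= uniq_s andbT; apply: contra not_span; apply: spanned_mem.
  - move=> u'; rewrite inE => /orP[/eqP->//|/closed_s u's].
    by rewrite inE u's orbT.
  - by move=> u'; rewrite inE => /orP[/eqP->//|/Qs].
  by exists t; split=> // u' u's; apply: us_t; rewrite inE u's orbT.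
have [s_root|/existsNP[p /not_implyP[Qp not_span]]] :=
    pselect (forall p, Q p -> spanned s (mk_vertex (tnil A (tag p)))); last first.
  by apply: (add (mk_vertex (tnil A (tag p)))) => //; [apply/negP|rewrite mem_head].
have [s_step|] := pselect (forall p (w : tree A (tag p)) k (a : A (tag w) k),
    mk_vertex w \in s -> spanned s (mk_vertex (tsnoc a))).
  by exists s; split=> // p w Qp; apply: spanned_copy => //; apply: s_root.
case/existsNP=> p /existsNP[w /existsNP[k /existsNP[a /not_implyP[ws not_span]]]].
apply: (add (mk_vertex (tsnoc a))); first exact: Qs ws.
  exact/negP.
by rewrite inE vparent_tsnoc ws orbT.
Qed.

End Families.

(** * Reducedness and smaller basis forests *)

Section Exchange.
Variables (dI dA : Order.disp_t) (I : finOrderType dI).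
Variables (A : I -> I -> finOrderType dA) (n : I -> nat).
Variables (R : realType) (M V : I -> vectType R[i]).
Variables (v : forall q, (n q).-tuple (V q)) (x : framed A M V).
Local Notation spanned := (spanned v x).
Local Notation indep := (indep v x).
Implicit Types S : forest A n.

Lemma is_basis_indep S : is_basis v S x -> indep (vertices S).
Proof.
by move=> basisS j; have := basis_free (basisS j); rewrite family_atE filter_predT.
Qed.

Lemma is_reduced_spanned S p (w : tree A (tag p)) :
    is_reduced v S x -> corona S w ->
  spanned [seq u <- vertices S | vertex_lt (tagged u) w] (mk_vertex w).
Proof. by move=> redS /redS; rewrite family_atE. Qed.

Lemma notin_root S p : is_subforest S -> tnil A (tag p) \notin S p -> S p = fset0.
Proof.
move=> subS notin; apply/eqP; rewrite -[_ == _]negbK -/(_ != _).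
apply/fset0Pn => -[w /subS wS]; case/negP: notin; apply: wS.
exact: prefix0s.
Qed.

Lemma vertex_lt_upto S p p' (w : tree A (tag p')) : (p' <= p)%O ->
  {subset [seq u <- vertices S | vertex_lt (tagged u) w] <= vertices_upto p S}.
Proof.
move=> p'p u; rewrite !mem_filter => /andP[lt_u ->]; rewrite andbT.
by apply: le_trans p'p; case/orP: lt_u => [/ltW//|/andP[/eqP eq_u _]]; rewrite eq_u.
Qed.

(** A root, or a child of a vertex of S, is in S or in its corona. In the latter case reducedness
    uses only earlier vertices, hence only copies up to p, so [spanned_copy] applies. *)
Lemma reduced_spanned_upto S p p' (w : tree A (tag p')) :
    is_subforest S -> is_reduced v S x -> (p' <= p)%O ->
  spanned (vertices_upto p S) (mk_vertex w).
Proof.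
move=> subS redS p'p; apply: spanned_copy => [|p'' {p' p'p} {}w k a].
  have [inS|notin] := boolP (tnil A (tag p') \in S p').
    by apply: spanned_mem; rewrite mem_filter /= p'p mem_vertices.
  apply: spanned_sub (vertex_lt_upto p'p) _.
  by apply: is_reduced_spanned => //; apply/corona_root/notin_root.
rewrite mem_filter mem_vertices => /andP[/= p''p wS].
have [inS|notin] := boolP (tsnoc a \in S p'').
  by apply: spanned_mem; rewrite mem_filter /= p''p mem_vertices.
apply: spanned_sub (vertex_lt_upto p''p) _.
by apply: is_reduced_spanned => //; apply: corona_step.
Qed.

(** If w is a root, S_p lacks its root and is empty. Otherwise the parent of w lies in S' and is
    smaller than w, so it lies in S. *)
Lemma corona_of_smaller S S' p (w : tree A (tag p)) :
    is_subforest S -> is_subforest S' -> w \in S' p -> w \notin S p ->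
    (forall u, (word u < word w)%O -> u \in S' p -> u \in S p) ->
  corona S w.
Proof.
move=> subS subS'; elim/tree_ind: w => [_ notin _|w k a _ wS' notin lt_in].
  exact/corona_root/notin_root.
apply: corona_step => //; apply: lt_in; first exact: word_tsnoc.
by apply: subS' wS'; apply: prefix_rcons.
Qed.

Lemma reduced_not_lt S S' :
    is_subforest S -> is_subforest S' -> is_reduced v S x ->
    indep (vertices S') -> ~ forest_lt S' S.
Proof.
move=> subS subS' redS indepS' [p [eqS lt_p]].
have le_p : (#|` S' p| <= #|` S p|)%N.
  apply: card_tree_le => //; apply: size_indep_le; first exact: indep_filter.
  by case=> p' w; rewrite mem_filter => /andP[p'p _]; apply: reduced_spanned_upto.
have [w [wS' wS eq_lt]] := tree_lt_smaller lt_p le_p.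
have coronaS : corona S w.
  by apply: (corona_of_smaller subS subS' wS' wS) => u /eq_lt ->.
(* The vertices of S before w all lie in S', by [eqS] in the copies before p and by [eq_lt] in p
   itself, and w is not among them. *)
have := is_reduced_spanned redS coronaS; apply/negP.
apply: (indep_not_spanned indepS'); rewrite ?mem_vertices //.
  move=> [p' u]; rewrite mem_filter !mem_vertices /vertex_lt /=.
  case/andP=> /orP[p'p|]; first by rewrite eqS.
  by case/andP=> /eqP eq_p; case: _ / (esym eq_p) u => u /eq_lt ->.
by rewrite mem_filter /vertex_lt /= !ltxx andbF.
Qed.

Lemma not_reduced_lt S :
    is_subforest S -> is_basis v S x -> ~ is_reduced v S x ->
  exists S', [/\ is_subforest S', forest_lt S' S & is_basis v S' x].
Proof.
move=> subS basisS /existsNP[p /existsNP[w /not_implyP[coronaS]]].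
rewrite family_atE => /negP not_span.
have indepS := is_basis_indep basisS.
have closedS := subforest_parent_closed subS.
(* This covers both kinds of corona vertex and is what closes w together with s under parents. *)
have w_parent : parent w \in S p /\ (word (parent w) < word w)%O \/
    vparent (mk_vertex w) = mk_vertex w.
  case: coronaS => [|w' k a w'S _]; first by right.
  by left; rewrite parent_tsnoc; split=> //; apply: word_tsnoc.
set s := [seq _ <- _ | _] in not_span.
have indep_s : indep (mk_vertex w :: s).
  by apply: indep_cons => //; apply: indep_filter.
have wS : w \notin S p.
  by case: coronaS => [->|//]; rewrite inE.
have uniq_s : uniq (mk_vertex w :: s).
  rewrite /= filter_uniq ?uniq_vertices // andbT mem_filter mem_vertices.
  by rewrite (negbTE wS) andbF.
have closed_s : parent_closed (mk_vertex w :: s).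
  move=> u; rewrite inE => /orP[/eqP->|].
    case: w_parent => [[wS' lt_w]|->]; last exact: mem_head.
    by rewrite inE mem_filter mem_vertices wS' /vertex_lt eqxx lt_w !orbT.
  case: u => p' u; rewrite mem_filter => /andP[lt_u uS].
  rewrite inE mem_filter (closedS _ uS) andbT; apply/orP; right.
  case/orP: lt_u => [p'p|/andP[eq_p lt_u]]; first by apply/orP; left.
  by apply/orP; right; rewrite eq_p (le_lt_trans (word_parent _)).
have upto_s : {in mk_vertex w :: s, forall u, (tag u <= p)%O}.
  move=> u; rewrite inE => /orP[/eqP->//|/(vertex_lt_upto (lexx p))].
  by rewrite mem_filter => /andP[].
(* The first extension stays in the copies up to p, so that t1 can be compared in size with S there;
   the second makes the family spanning everywhere. *)
have [t1 [s_t1 [uniq1 closed1 indep1] upto1 span1]] :=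
  extend_indep (Q := fun p' => (p' <= p)%O) uniq_s closed_s indep_s upto_s.
have [//|t2 [t1_t2 [uniq2 closed2 indep2] _ span2]] :=
  extend_indep (Q := predT) uniq1 closed1 indep1.
have perm2 := perm_forest_of uniq2.
exists (forest_of t2); split; first exact: subforest_forest_of.
  have s_t2 u : u \in mk_vertex w :: s -> u \in t2 by move=> /s_t1/t1_t2.
  have wt2 : w \in forest_of t2 p by rewrite mem_forest_of s_t2 ?mem_head.
  have neq_p : forest_of t2 p != S p by apply: contraNneq wS => <-.
  (* The forests differ at p because of w, but the first difference p' may come earlier. *)
  case: (@arg_minP _ _ _ p (fun p' => forest_of t2 p' != S p') id neq_p).
  move=> p' neq_p' min_p'.
  have eq_lt p'' : (p'' < p')%O -> forest_of t2 p'' = S p''.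
    by move=> lt_p''; apply/eqP; apply: contraTT lt_p'' => /min_p'; rewrite -leNgt.
  exists p'; split=> //.
  move: (min_p' _ neq_p); rewrite le_eqVlt => /orP[/eqP eq_p|lt_p'].
    case: _ / (esym eq_p) neq_p' min_p' eq_lt => _ _ eq_lt.
    apply: (tree_lt_of_smaller _ wt2 wS) => [|u uS lt_u].
      apply: card_tree_le => [p'' /eq_lt//|].
      (* S up to p is independent and spanned by t1, and t1 is contained in t2 up to p. *)
      apply: (@leq_trans (size t1)).
        apply: size_indep_le; first exact: indep_filter.
        by case=> p'' u; rewrite mem_filter => /andP[p''p _]; apply: span1.
      apply: uniq_leq_size => // u ut1.
      by rewrite mem_filter upto1 // (perm_mem perm2) t1_t2.
    rewrite mem_forest_of s_t2 // inE mem_filter mem_vertices uS andbT.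
    by rewrite /vertex_lt eqxx lt_u !orbT.
  (* For p' < p every vertex of S in copy p' precedes w and so is in t2; the tree of t2 is strictly
     larger, hence smaller in the order. *)
  left; apply: fproper_ltn_card; rewrite fproperEneq eq_sym neq_p' /=.
  apply/fsubsetP => u uS; rewrite mem_forest_of s_t2 // inE mem_filter.
  by rewrite mem_vertices uS andbT /vertex_lt lt_p' orbT.
move=> j; rewrite family_atE filter_predT /basis_of.
rewrite (perm_indep _ indep2) ?andbT 1?perm_sym //.
rewrite eqEsubv subvf /=.
have /andP[/eqP <- _] := basisS j.
(* It suffices that t2 spans every vertex of S, because S is already a basis forest. *)
rewrite family_atE filter_predT; apply: span_fam_sub => -[p' u] _.
by apply: spanned_sub (span2 p' u isT) => u'; rewrite (perm_mem perm2).
Qed.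

End Exchange.

(** * Invariance under base change *)

Section BaseChange.
Variables (dI dA : Order.disp_t) (I : finOrderType dI).
Variables (A : I -> I -> finOrderType dA) (n : I -> nat).
Variables (R : realType) (M V : I -> vectType R[i]).
Variables (v : forall q, (n q).-tuple (V q)).
Variables (g : forall q, 'End(M q)) (g_bij : forall q, bijective (g q)).
Variable x : framed A M V.
Implicit Types S : forest A n.

Let g_ker q : lker (g q) == 0%VS.
Proof. exact/lker0P/bij_inj. Qed.

Lemma path_map_gl q j (w : qpath A q j) :
  Defs.path_map (gl_act g x) w = (g j \o Defs.path_map x w \o (g q)^-1)%VF.
Proof.
elim: w => [|i k u /= -> a]; first by rewrite comp_lfun1r lker0_compfV.
by apply/lfunP => y; rewrite !comp_lfunE /= lker0_lfunK.
Qed.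

Lemma val_at_gl (p : copies n) j (w : qpath A (tag p) j) :
  val_at v (gl_act g x) w = g j (val_at v x w).
Proof.
by rewrite /val_at path_map_gl !comp_lfunE /= lker0_lfunK.
Qed.

Lemma family_at_gl S P j :
  family_at v (gl_act g x) S P j = map (g j) (family_at v x S P j).
Proof.
rewrite !family_atE /fam -map_comp; apply: eq_map => u /=.
(* [eq_map] forgets the filter, so paths ending elsewhere also appear; there both sides come from
   the default 0, which g j fixes. *)
rewrite /untag; case: eqP => [e|_]; [exact: val_at_gl|by rewrite linear0].
Qed.

(** The injective map g j preserves the dimension of spans. *)
Lemma is_basis_gl S : is_basis v S (gl_act g x) -> is_basis v S x.
Proof.
move=> basisS j; have := basisS j; rewrite family_at_gl /basis_of /free.
rewrite -limg_span limg_dim_eq ?(eqP (g_ker j)) ?capv0 // size_map.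
case/andP=> /eqP eq_full ->; rewrite andbT eqEdim subvf /= -eq_full.
by rewrite limg_dim_eq ?(eqP (g_ker j)) ?capv0.
Qed.

Lemma is_reduced_gl S : is_reduced v S (gl_act g x) -> is_reduced v S x.
Proof.
move=> redS p w /redS; rewrite val_at_gl family_at_gl -limg_span.
by case/memv_imgP=> y y_span /(lker0P (g_ker _)) ->.
Qed.

End BaseChange.

(** * The decomposition on the orbit space *)

Local Open Scope classical_set_scope.
Local Open Scope ring_scope.

Theorem theorem7p7 (dI dA : Order.disp_t) (I : finOrderType dI)
    (A : I -> I -> finOrderType dA) (d n : I -> nat)
    (R : realType) (M V : I -> vectType R[i])
    (hM : forall q, \dim (fullv : {vspace M q}) = d q)
    (v : forall q, (n q).-tuple (V q))
    (hv : forall q, basis_of fullv (v q))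
    (S : forest A n) (hS : is_subforest S) :
  Z_ M v S =
    U_ M v S `\` \bigcup_(S' in [set S' : forest A n |
                                 is_subforest S' /\ forest_lt S' S]) U_ M v S'.
Proof.
apply/seteqP; split=> c /=.
  case=> x [xc basisS redS]; split; first by exists x.
  case=> S' [subS' lt_S'] [y yc basisS'].
  have /set_mem[x0 _ c_orbit] := valP c.
  (* The representatives x for S and y for S' may differ; both conditions are transported to the
     common point x0 of the orbit. *)
  move: xc yc; rewrite -c_orbit => /set_mem[g g_bij eq_x] /set_mem[h h_bij eq_y].
  rewrite -eq_x in redS; rewrite -eq_y in basisS'.
  have /is_basis_indep indepS' := is_basis_gl h_bij basisS'.
  exact: reduced_not_lt hS subS' (is_reduced_gl g_bij redS) indepS' lt_S'.
case=> -[x xc basisS] not_smaller; exists x; split=> //.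
apply: contrapT => /(not_reduced_lt hS basisS)[S' [subS' lt_S' basisS']].
by apply: not_smaller; exists S' => //; exists x.
Qed.
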